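(* The hypoplactic congruence $\ddot{\sim}$ on the free monoid $C_2^*$ is not finitely generated (as a monoid congruence). Therefore $\mathrm{hypo}(\mathcal{C}_2)$ has no finite presentation.
   Context: $|w|_a$ denotes the number of occurrences of the letter $a$ in the word $w$. Let $C_2=\{1<2<\bar2<\bar1\}$ and $C_2^*$ the free monoid over it; the symbols $3$ and $\bar3$ never occur. For $i\in\{1,2\}$, $w$ has an $i$-inversion if $w=w_1xw_2yw_3$ with $x\in\{i,\overline{i+1}\}$, $y\in\{i+1,\bar i\}$. Quasi-crystal structure on $C_2^*$: $\mathrm{wt}(w)=(|w|_1-|w|_{\bar1},|w|_2-|w|_{\bar2})$. For $i\in\{1,2\}$: if $w$ has an $i$-inversion then $\ddot{\varepsilon}_i(w)=\ddot{\varphi}_i(w)=+\infty$ and $\ddot{e}_i(w),\ddot{f}_i(w)$ are undefined; otherwise $\ddot{\varepsilon}_i(w)=|w|_{i+1}+|w|_{\bar i}$, $\ddot{\varphi}_i(w)=|w|_i+|w|_{\overline{i+1}}$; $\ddot{e}_i(w)$ is defined iff $\ddot{\varepsilon}_i(w)>0$ and is obtained by replacing the right-most letter of $w$ in $\{i+1,\bar i\}$ by its image ($\ddot{e}_1:2\mapsto1,\bar1\mapsto\bar2$; $\ddot{e}_2:\bar2\mapsto2$); $\ddot{f}_i(w)$ is defined iff $\ddot{\varphi}_i(w)>0$ and is obtained by replacing the left-most letter of $w$ in $\{i,\overline{i+1}\}$ by its image ($\ddot{f}_1:1\mapsto2,\bar2\mapsto\bar1$; $\ddot{f}_2:2\mapsto\bar2$).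 The connected component $C_2^*(w)$ is the set of words obtained from $w$ by finitely many (defined) applications of these operators. Hypoplactic congruence: $u\ddot{\sim}v$ iff there is a bijection $\psi:C_2^*(u)\to C_2^*(v)$ with $\psi(u)=v$ preserving $\mathrm{wt},\ddot{\varepsilon}_i,\ddot{\varphi}_i$ and such that $\ddot{e}_i(\psi(x))$ is defined iff $\ddot{e}_i(x)$ is (then $\psi(\ddot{e}_i(x))=\ddot{e}_i(\psi(x))$), likewise for $\ddot{f}_i$. It is a monoid congruence on $C_2^*$; $\mathrm{hypo}(\mathcal{C}_2)=C_2^*/\ddot{\sim}$. *)

(* Defs.v *)
From HB Require Import structures.
From mathcomp Require Import all_boot ssralg ssrint.
From mathcomp Require Import boolp classical_sets functions.

Set Implicit Arguments.
Unset Strict Implicit.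
Unset Printing Implicit Defensive.

(* The free monoid over [A] is [seq A], with concatenation and [[::]]. *)

Definition monoid_congruence (A : Type) (R : seq A -> seq A -> Prop) : Prop :=
  [/\ forall u, R u u,
      forall u v, R u v -> R v u,
      forall u v w, R u v -> R v w -> R u w &
      forall u v u' v', R u v -> R u' v' -> R (u ++ u') (v ++ v')].

Record congruence (A : Type) := Congruence {
  congruence_rel :> seq A -> seq A -> Prop;
  congruenceP : monoid_congruence congruence_rel
}.

Inductive generated_rel (A : eqType) (S : seq (seq A * seq A)) :
    seq A -> seq A -> Prop :=
  | gen_base u v : (u, v) \in S -> generated_rel S u v
  | gen_refl u : generated_rel S u u
  | gen_sym u v : generated_rel S u v -> generated_rel S v u
  | gen_trans u v w :
      generated_rel S u v -> generated_rel S v w -> generated_rel S u w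
  | gen_cat u v u' v' : generated_rel S u v -> generated_rel S u' v' ->
      generated_rel S (u ++ u') (v ++ v').

Lemma generated_relP (A : eqType) (S : seq (seq A * seq A)) :
  monoid_congruence (generated_rel S).
Proof.
by split; [exact: gen_refl | exact: gen_sym | exact: gen_trans | exact: gen_cat].
Qed.

Definition generated_congruence (A : eqType) (S : seq (seq A * seq A)) :
  congruence A := Congruence (generated_relP S).

Definition finitely_generated (A : eqType) (C : congruence A) : Prop :=
  exists S : seq (seq A * seq A),
    forall u v, C u v <-> generated_congruence S u v.

Definition congruence_dec (A : Type) (C : congruence A) : rel (seq A) :=
  fun u v => `[< C u v >].

Lemma congruence_dec_refl (A : Type) (C : congruence A) :
  reflexive (congruence_dec C).
Proof. by move=> u; apply/asboolP; case: (congruenceP C). Qed.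

Lemma congruence_dec_sym (A : Type) (C : congruence A) :
  symmetric (congruence_dec C).
Proof.
by move=> u v; case: (congruenceP C) => _ Csym _ _;
  apply/asboolP/asboolP => /Csym.
Qed.

Lemma congruence_dec_trans (A : Type) (C : congruence A) :
  transitive (congruence_dec C).
Proof.
move=> v u w; case: (congruenceP C) => _ _ Ctr _.
by move=> /asboolP uv /asboolP vw; apply/asboolP; apply: Ctr uv vw.
Qed.

Canonical congruence_equiv (A : Type) (C : congruence A) :=
  EquivRel (congruence_dec C) (congruence_dec_refl C)
    (congruence_dec_sym C) (@congruence_dec_trans A C).

Local Open Scope quotient_scope.

Definition quotient_monoid (A : choiceType) (C : congruence A) : Type :=
  {eq_quot (congruence_equiv C)}.

HB.instance Definition _ (A : choiceType) (C : congruence A) :=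
  Choice.on (quotient_monoid C).
HB.instance Definition _ (A : choiceType) (C : congruence A) :=
  EqQuotient.on (quotient_monoid C).

Definition quotient_one (A : choiceType) (C : congruence A) :
  quotient_monoid C := \pi_(quotient_monoid C) [::].

Definition quotient_mul (A : choiceType) (C : congruence A)
  (x y : quotient_monoid C) : quotient_monoid C :=
  \pi_(quotient_monoid C) (repr x ++ repr y).

Lemma quotient_eqP (A : choiceType) (C : congruence A) (u v : seq A) :
  \pi_(quotient_monoid C) u = \pi_(quotient_monoid C) v <-> C u v.
Proof.
split; first by move=> /eqP; rewrite piE => /asboolP.
by move=> Cuv; apply/eqP; rewrite piE; apply/asboolP.
Qed.

Lemma quotient_mulE (A : choiceType) (C : congruence A) (u v : seq A) :
  quotient_mul (\pi_(quotient_monoid C) u) (\pi_(quotient_monoid C) v) =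
  \pi_(quotient_monoid C) (u ++ v).
Proof.
apply/quotient_eqP; case: (congruenceP C) => _ _ _ Ccat.
by apply: Ccat; apply/quotient_eqP; rewrite reprK.
Qed.

Lemma quotient_mulA (A : choiceType) (C : congruence A) :
  associative (@quotient_mul A C).
Proof.
elim/quotW=> u; elim/quotW=> v; elim/quotW=> w.
rewrite (quotient_mulE C v w) (quotient_mulE C u (v ++ w)).
by rewrite (quotient_mulE C u v) (quotient_mulE C (u ++ v) w) catA.
Qed.

Lemma quotient_mul1g (A : choiceType) (C : congruence A) :
  left_id (quotient_one C) (@quotient_mul A C).
Proof. by elim/quotW=> u; rewrite (quotient_mulE C [::] u). Qed.

Lemma quotient_mulg1 (A : choiceType) (C : congruence A) :
  right_id (quotient_one C) (@quotient_mul A C).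
Proof. by elim/quotW=> u; rewrite (quotient_mulE C u [::]) cats0. Qed.

HB.instance Definition _ (A : choiceType) (C : congruence A) :=
  isMonoid.Build (quotient_monoid C)
    (@quotient_mulA A C) (@quotient_mul1g A C) (@quotient_mulg1 A C).

(* [phi] is an isomorphism of monoids. *)
Definition finitely_presented (M : monoidType) : Prop :=
  exists (A : finType) (S : seq (seq A * seq A))
         (phi : quotient_monoid (generated_congruence S) -> M),
    monoid_morphism phi /\ bijective phi.

Local Close Scope quotient_scope.

(* [L1], [L2], [L2b], [L1b] are the letters 1, 2, \bar 2, \bar 1 of C_2, and
   [I1], [I2] are the indices 1, 2 of the operators. *)

Inductive letter := L1 | L2 | L2b | L1b.

Definition bools_of_letter (l : letter) : bool * bool :=
  match l with
  | L1 => (false, false) | L2 => (false, true)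
  | L2b => (true, false) | L1b => (true, true)
  end.

Definition letter_of_bools (b : bool * bool) : letter :=
  match b with
  | (false, false) => L1 | (false, true) => L2
  | (true, false) => L2b | (true, true) => L1b
  end.

Lemma bools_of_letterK : cancel bools_of_letter letter_of_bools.
Proof. by case. Qed.

HB.instance Definition _ := Finite.copy letter (can_type bools_of_letterK).

Notation word := (seq letter).

Inductive index := I1 | I2.

(* Membership in {i, \overline{i+1}}; \bar 3 never occurs. *)
Definition phi_letter (i : index) : pred letter :=
  fun x => match i, x with
  | I1, L1 | I1, L2b | I2, L2 => true
  | _, _ => false
  end.

(* Membership in {i+1, \bar i}; 3 never occurs. *)
Definition eps_letter (i : index) : pred letter :=
  fun x => match i, x with
  | I1, L2 | I1, L1b | I2, L2b => true
  | _, _ => false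
  end.

(* See [has_inversionP] for the description by factorizations. *)
Fixpoint has_inversion (i : index) (w : word) : bool :=
  if w is x :: s then
    (phi_letter i x && has (eps_letter i) s) || has_inversion i s
  else false.

Lemma has_inversionP (i : index) (w : word) :
  reflect (exists w1 x w2 y w3,
             [/\ w = w1 ++ x :: w2 ++ y :: w3, phi_letter i x & eps_letter i y])
          (has_inversion i w).
Proof.
elim: w => [|a s IH] /=; first by constructor=> -[[|? ?] [? [? [? [? []]]]]].
apply: (iffP orP) => [[/andP[pa]|/IH]|].
- case/(has_nthP L1)=> k ks es; exists [::], a, (take k s).
  exists (nth L1 s k), (drop k.+1 s).
  by split=> //=; rewrite -drop_nth // cat_take_drop.
- by move=> [w1 [x [w2 [y [w3 [-> px ey]]]]]]; exists (a :: w1), x, w2, y, w3.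
- move=> [[|b w1] [x [w2 [y [w3 [/= [-> E] px ey]]]]]].
  + by left; rewrite E px has_cat /= ey orbT.
  + by right; apply/IH; exists w1, x, w2, y, w3.
Qed.

Definition wt (w : word) : int * int :=
  ((count_mem L1 w)%:Z - (count_mem L1b w)%:Z,
   (count_mem L2 w)%:Z - (count_mem L2b w)%:Z)%R.

(* [None] stands for +oo. *)
Definition eps (i : index) (w : word) : option nat :=
  if has_inversion i w then None else Some (count (eps_letter i) w).

Definition phi (i : index) (w : word) : option nat :=
  if has_inversion i w then None else Some (count (phi_letter i) w).

Fixpoint replace_leftmost (p : pred letter) (g : letter -> letter) (w : word) :
    word :=
  if w is x :: s then
    if p x then g x :: s else x :: replace_leftmost p g s
  else [::].

Definition replace_rightmost (p : pred letter) (g : letter -> letter)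
  (w : word) : word := rev (replace_leftmost p g (rev w)).

(* The values outside [eps_letter i] are irrelevant. *)
Definition e_letter (i : index) (x : letter) : letter :=
  match i, x with
  | I1, L2 => L1 | I1, L1b => L2b | I2, L2b => L2
  | _, _ => x
  end.

(* The values outside [phi_letter i] are irrelevant. *)
Definition f_letter (i : index) (x : letter) : letter :=
  match i, x with
  | I1, L1 => L2 | I1, L2b => L1b | I2, L2 => L2b
  | _, _ => x
  end.

(* [None] stands for undefined. *)
Definition e_op (i : index) (w : word) : option word :=
  if eps i w is Some n.+1
  then Some (replace_rightmost (eps_letter i) (e_letter i) w) else None.

Definition f_op (i : index) (w : word) : option word :=
  if phi i w is Some n.+1
  then Some (replace_leftmost (phi_letter i) (f_letter i) w) else None.

Inductive component (w : word) : word -> Prop :=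
  | component_refl : component w w
  | component_e i x y : component w x -> e_op i x = Some y -> component w y
  | component_f i x y : component w x -> f_op i x = Some y -> component w y.

(* Only the restriction of [psi] to the component of [u] matters.  The
   equations on [omap psi] say both that the two sides are defined
   simultaneously and that [psi] commutes with the operators. *)
Definition quasi_crystal_iso (u v : word) (psi : word -> word) : Prop :=
  [/\ set_bij (component u) (component v) psi, psi u = v &
      forall x, component u x ->
        wt (psi x) = wt x /\
        forall i, [/\ eps i (psi x) = eps i x, phi i (psi x) = phi i x,
                      e_op i (psi x) = omap psi (e_op i x) &
                      f_op i (psi x) = omap psi (f_op i x)]].

Definition hypo_rel (u v : word) : Prop :=
  exists psi, quasi_crystal_iso u v psi.

Lemma has_inversion_cat i u v :
  has_inversion i (u ++ v) =
  [|| has_inversion i u, has_inversion i v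
    | has (phi_letter i) u && has (eps_letter i) v].
Proof.
elim: u => [|a u IH] /=; first by rewrite orbF.
rewrite IH has_cat.
by case: (phi_letter i a); case: (has (eps_letter i) u); case: (has_inversion i u);
  case: (has_inversion i v); case: (has (phi_letter i) u);
  case: (has (eps_letter i) v).
Qed.

Lemma wt_cat u v :
  wt (u ++ v) = ((wt u).1 + (wt v).1, (wt u).2 + (wt v).2)%R.
Proof.
rewrite /wt !count_cat !PoszD /=.
by congr pair; rewrite GRing.opprD GRing.addrACA.
Qed.

(* The common shape of [eps] and [phi] on a concatenation: [p] is [phi i u],
   [q] is [eps i v], and [a], [b] are the values to be added. *)
Definition quasi_add (p q a b : option nat) : option nat :=
  match p, q, a, b with
  | Some p, Some q, Some a, Some b =>
      if (0 < p) && (0 < q) then None else Some (a + b)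
  | _, _, _, _ => None
  end.

Lemma eps_cat i u v :
  eps i (u ++ v) = quasi_add (phi i u) (eps i v) (eps i u) (eps i v).
Proof.
rewrite /eps /phi has_inversion_cat !has_count count_cat.
by case: (has_inversion i u); case: (has_inversion i v).
Qed.

Lemma phi_cat i u v :
  phi i (u ++ v) = quasi_add (phi i u) (eps i v) (phi i u) (phi i v).
Proof.
rewrite /eps /phi has_inversion_cat !has_count count_cat.
by case: (has_inversion i u); case: (has_inversion i v).
Qed.

Lemma replace_leftmost_cat p g u v :
  replace_leftmost p g (u ++ v) =
  if has p u then replace_leftmost p g u ++ v
  else u ++ replace_leftmost p g v.
Proof.
elim: u => [|a u IH] //=; case: (p a) => //=.
by rewrite IH; case: (has p u).
Qed.

Lemma replace_rightmost_cat p g u v :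
  replace_rightmost p g (u ++ v) =
  if has p v then u ++ replace_rightmost p g v
  else replace_rightmost p g u ++ v.
Proof.
rewrite /replace_rightmost rev_cat replace_leftmost_cat has_rev.
by case: (has p v); rewrite rev_cat revK.
Qed.

Lemma size_replace_leftmost p g w : size (replace_leftmost p g w) = size w.
Proof. by elim: w => //= a w IH; case: (p a) => //=; rewrite IH. Qed.

Lemma size_e i u v : e_op i u = Some v -> size v = size u.
Proof.
rewrite /e_op; case: (eps i u) => [[|n]|] // [<-].
by rewrite /replace_rightmost size_rev size_replace_leftmost size_rev.
Qed.

Lemma size_f i u v : f_op i u = Some v -> size v = size u.
Proof.
rewrite /f_op; case: (phi i u) => [[|n]|] // [<-].
by rewrite size_replace_leftmost.
Qed.

Lemma e_cat i u v :
  e_op i (u ++ v) =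
  if eps i (u ++ v) is None then None
  else if eps i v is Some _.+1 then omap (cat u) (e_op i v)
  else omap (cat^~ v) (e_op i u).
Proof.
rewrite /e_op eps_cat replace_rightmost_cat has_count /quasi_add /eps /phi.
case: (has_inversion i u) => //; case: (has_inversion i v) => //.
case: (count (phi_letter i) u) => [|p]; case: (count (eps_letter i) v) => [|q] //=.
- by rewrite addn0; case: (count (eps_letter i) u).
- by rewrite addnS.
- by rewrite addn0; case: (count (eps_letter i) u).
Qed.

Lemma f_cat i u v :
  f_op i (u ++ v) =
  if phi i (u ++ v) is None then None
  else if phi i u is Some _.+1 then omap (cat^~ v) (f_op i u)
  else omap (cat u) (f_op i v).
Proof.
rewrite /f_op phi_cat replace_leftmost_cat has_count /quasi_add /eps /phi.
case: (has_inversion i u) => //; case: (has_inversion i v) => //.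
case: (count (phi_letter i) u) => [|p]; case: (count (eps_letter i) v) => [|q] //=.
- by rewrite add0n; case: (count (phi_letter i) v).
- by rewrite add0n; case: (count (phi_letter i) v).
Qed.

Lemma size_component w x : component w x -> size x = size w.
Proof. by elim=> // i y z _ <- => [/size_e|/size_f]. Qed.

Lemma component_cat u v w : component (u ++ v) w ->
  exists x y, [/\ component u x, component v y & w = x ++ y].
Proof.
elim=> [|i _ z _ [x [y [ux vy ->]]]|i _ z _ [x [y [ux vy ->]]]].
- by exists u, v; split=> //; exact: component_refl.
- rewrite e_cat; case: (eps i (x ++ y)) => // _.
  have left : omap (cat^~ y) (e_op i x) = Some z -> exists x y,
      [/\ component u x, component v y & z = x ++ y].
    case E: (e_op i x) => [x'|] //= [<-]; exists x', y; split=> //.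
    exact: component_e ux E.
  case: (eps i y) => [[|n]|] //.
  case E: (e_op i y) => [y'|] //= [<-]; exists x, y'; split=> //.
  exact: component_e vy E.
- rewrite f_cat; case: (phi i (x ++ y)) => // _.
  have right : omap (cat x) (f_op i y) = Some z -> exists x y,
      [/\ component u x, component v y & z = x ++ y].
    case E: (f_op i y) => [y'|] //= [<-]; exists x, y'; split=> //.
    exact: component_f vy E.
  case: (phi i x) => [[|n]|] //.
  case E: (f_op i x) => [x'|] //= [<-]; exists x', y; split=> //.
  exact: component_f ux E.
Qed.

(* Compatibility with the operators makes [psi] map the component of [u] onto
   that of [v], so only injectivity remains to be checked. *)
Lemma quasi_crystal_isoI u v psi :
    (forall x y, component u x -> component u y -> psi x = psi y -> x = y) ->
    psi u = v ->
    (forall x, component u x ->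
      wt (psi x) = wt x /\
      forall i, [/\ eps i (psi x) = eps i x, phi i (psi x) = phi i x,
                    e_op i (psi x) = omap psi (e_op i x) &
                    f_op i (psi x) = omap psi (f_op i x)]) ->
  quasi_crystal_iso u v psi.
Proof.
move=> inj uv com; split=> //; split.
- move=> x; elim=> [|i y z uy vy E|i y z uy vy E].
  + by rewrite uv; exact: component_refl.
  + have [_ /(_ i)[_ _ Ee _]] := com _ uy.
    by apply: (@component_e _ i _ _ vy); rewrite Ee E.
  + have [_ /(_ i)[_ _ _ Ef]] := com _ uy.
    by apply: (@component_f _ i _ _ vy); rewrite Ef E.
- by move=> x y; rewrite !inE => ux uy; apply: inj.
- move=> x; elim=> [|i _ z _ [y /= uy <-]|i _ z _ [y /= uy <-]].
  + by exists u => //; exact: component_refl.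
  + have [_ /(_ i)[_ _ -> _]] := com _ uy.
    case E: (e_op i y) => [y'|] //= [<-]; exists y' => //.
    exact: component_e uy E.
  + have [_ /(_ i)[_ _ _ ->]] := com _ uy.
    case E: (f_op i y) => [y'|] //= [<-]; exists y' => //.
    exact: component_f uy E.
Qed.

Lemma hypo_rel_refl u : hypo_rel u u.
Proof.
exists id; apply: quasi_crystal_isoI => // x _; split=> // i.
by split=> //; [case: (e_op i x) | case: (f_op i x)].
Qed.

Lemma hypo_rel_trans u v w : hypo_rel u v -> hypo_rel v w -> hypo_rel u w.
Proof.
move=> [psi [[psiF psiI _] psiu comp]] [chi [[_ chiI _] chiv comc]].
exists (chi \o psi); apply: quasi_crystal_isoI => /=.
- move=> x y ux uy /chiI E; apply: psiI; rewrite ?inE //.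
  by apply: E; rewrite inE; apply: psiF.
- by rewrite psiu.
- move=> x ux; have [wx hx] := comp _ ux.
  have [wpx hc] := comc _ (psiF _ ux); split; first by rewrite wpx.
  move=> i; have [e1 p1 E1 F1] := hx i; have [e2 p2 E2 F2] := hc i.
  split; rewrite ?e2 ?p2 ?E2 ?F2 // ?E1 ?F1.
  + by case: (e_op i x).
  + by case: (f_op i x).
Qed.

Lemma hypo_rel_sym u v : hypo_rel u v -> hypo_rel v u.
Proof.
move=> [psi [psiB psiu com]].
have [psiF psiI psiS] := psiB.
have uu := component_refl u.
pose chi y := xget [::] (fun x => component u x /\ psi x = y).
have chiP y : component v y -> component u (chi y) /\ psi (chi y) = y.
  move=> /psiS[x /= ux xy].
  exact: (xgetPex [::] (ex_intro (fun z => _ /\ _) x (conj ux xy))).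
have chiK x : component u x -> chi (psi x) = x.
  move=> ux; have [ux' E] := chiP _ (psiF _ ux).
  by apply: psiI; rewrite ?inE.
exists chi; apply: quasi_crystal_isoI.
- by move=> x y /chiP[_ {2}<-] /chiP[_ {2}<-] ->.
- by rewrite -psiu chiK.
- move=> y vy; have [ux xy] := chiP _ vy.
  have [wx hx] := com _ ux; split; first by rewrite -wx xy.
  move=> i; have [] := hx i; rewrite xy => -> -> -> ->; split=> //.
  + case E: (e_op i (chi y)) => [x'|] //=; rewrite chiK //.
    exact: component_e ux E.
  + case E: (f_op i (chi y)) => [x'|] //=; rewrite chiK //.
    exact: component_f ux E.
Qed.

Lemma hypo_rel_cat u v u' v' :
  hypo_rel u v -> hypo_rel u' v' -> hypo_rel (u ++ u') (v ++ v').
Proof.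
move=> [psi [[psiF psiI _] psiu com]] [chi [[chiF chiI _] chiu comc]].
pose Psi w := psi (take (size u) w) ++ chi (drop (size u) w).
have PsiE x y : size x = size u -> Psi (x ++ y) = psi x ++ chi y.
  by move=> sx; rewrite /Psi -sx take_size_cat // drop_size_cat.
exists Psi; apply: quasi_crystal_isoI.
- move=> w1 w2 /component_cat[x [y [ux uy ->]]].
  move=> /component_cat[x' [y' [ux' uy' ->]]].
  rewrite !PsiE ?(size_component ux) ?(size_component ux') // => /eqP.
  rewrite eqseq_cat; last first.
    by rewrite (size_component (psiF _ ux)) (size_component (psiF _ ux')).
  by case/andP=> /eqP/psiI ->; rewrite ?inE // => /eqP/chiI ->; rewrite ?inE.
- by rewrite PsiE // psiu chiu.
- move=> _ /component_cat[x [y [ux uy ->]]].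
  have sx := size_component ux; rewrite PsiE //.
  have [wx hx] := com _ ux; have [wy hy] := comc _ uy.
  split; first by rewrite !wt_cat wx wy.
  move=> i; have [ex px Ex Fx] := hx i; have [ey py Ey Fy] := hy i.
  split; rewrite ?eps_cat ?phi_cat ?e_cat ?f_cat ?eps_cat ?phi_cat
    ?ex ?px ?ey ?py ?Ex ?Ey ?Fx ?Fy //.
  + case: (quasi_add _ _ _ _) => //=.
    have el : omap (cat^~ (chi y)) (omap psi (e_op i x)) =
              omap Psi (omap (cat^~ y) (e_op i x)).
      by case E: (e_op i x) => [x'|] //=; rewrite PsiE // (size_e E).
    case: (eps i y) => [[|n]|] //.
    by case: (e_op i y) => [y'|] //=; rewrite PsiE.
  + case: (quasi_add _ _ _ _) => //=.
    have fr : omap (cat (psi x)) (omap chi (f_op i y)) =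
              omap Psi (omap (cat x) (f_op i y)).
      by case: (f_op i y) => [y'|] //=; rewrite PsiE.
    case: (phi i x) => [[|n]|] //.
    by case E: (f_op i x) => [x'|] //=; rewrite PsiE // (size_f E).
Qed.

Lemma hypo_relP : monoid_congruence hypo_rel.
Proof.
split; [exact: hypo_rel_refl | exact: hypo_rel_sym | exact: hypo_rel_trans |].
exact: hypo_rel_cat.
Qed.

Definition hypo_congruence : congruence letter := Congruence hypo_relP.

Definition hypo_C2 : monoidType := quotient_monoid hypo_congruence.

(* Main.v *)
(* For n >= 1 the words u_n = 2 \bar1^n 1^n 2 are all congruent: every word in
   the component of u_n has a 1-inversion, so only the operators of index 2 act,
   and they only see the two end letters.  On the other hand
   2 \bar1^n 1^n and \bar1^n 1^n 2 are alone in their classes, hence so are all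
   proper factors of u_n, and no relation between words shorter than u_n can
   rewrite it.  Finally, generators of a congruence can be transported along an
   isomorphism of the quotient monoids, so having a finite presentation on some
   generating set is the same as having one on the given finite alphabet. *)

From mathcomp Require Import all_boot ssralg ssrint.
From mathcomp Require Import boolp classical_sets.
Require Import Defs.

Set Implicit Arguments.
Unset Strict Implicit.
Unset Printing Implicit Defensive.

Local Open Scope quotient_scope.

Local Arguments phi_letter !i !x /.
Local Arguments eps_letter !i !x /.

(** * Congruent words have equal invariants, and applying an operator keeps them congruent *)

Lemma quasi_crystal_iso_component u v psi u' :
  quasi_crystal_iso u v psi -> component u u' ->
  quasi_crystal_iso u' (psi u') psi.
Proof.
move=> [[_ inj _] _ com] uu'.
have tr x : component u' x -> component u x.
  elim=> // i y z _; [exact: component_e | exact: component_f].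
apply: quasi_crystal_isoI => // [x y /tr ux /tr uy|x /tr]; last exact: com.
by apply: inj; rewrite inE.
Qed.

Lemma hypo_rel_eps i u v : hypo_rel u v -> eps i v = eps i u.
Proof.
by move=> [psi [_ <- com]]; have [_ /(_ i)[]] := com _ (component_refl u).
Qed.

Lemma hypo_rel_phi i u v : hypo_rel u v -> phi i v = phi i u.
Proof.
by move=> [psi [_ <- com]]; have [_ /(_ i)[]] := com _ (component_refl u).
Qed.

Lemma hypo_rel_e i u v u' : hypo_rel u v -> e_op i u = Some u' ->
  exists2 v', e_op i v = Some v' & hypo_rel u' v'.
Proof.
move=> [psi psiP] E; have [_ Ev com] := psiP.
have [_ /(_ i)[_ _ Ee _]] := com _ (component_refl u).
exists (psi u'); first by rewrite -Ev Ee E.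
exists psi; apply: quasi_crystal_iso_component psiP _.
exact: component_e (component_refl u) E.
Qed.

Lemma hypo_rel_f i u v u' : hypo_rel u v -> f_op i u = Some u' ->
  exists2 v', f_op i v = Some v' & hypo_rel u' v'.
Proof.
move=> [psi psiP] E; have [_ Ev com] := psiP.
have [_ /(_ i)[_ _ _ Ef]] := com _ (component_refl u).
exists (psi u'); first by rewrite -Ev Ef E.
exists psi; apply: quasi_crystal_iso_component psiP _.
exact: component_f (component_refl u) E.
Qed.

(** * Words without 1-inversions *)

Lemma has_inversion_has i w :
  has_inversion i w -> has (phi_letter i) w && has (eps_letter i) w.
Proof.
elim: w => //= a w IH /orP[/andP[-> ->]|/IH/andP[-> ->]]; rewrite !orbT //.
Qed.

Lemma eps_SomeP i w n :
  eps i w = Some n -> has_inversion i w = false /\ count (eps_letter i) w = n.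
Proof. by rewrite /eps; case: has_inversion => // -[]. Qed.

Lemma phi_SomeP i w n :
  phi i w = Some n -> has_inversion i w = false /\ count (phi_letter i) w = n.
Proof. by rewrite /phi; case: has_inversion => // -[]. Qed.

Lemma phi_letter1E x : phi_letter I1 x = ~~ eps_letter I1 x.
Proof. by case: x. Qed.

Lemma all_phi1 t : all (phi_letter I1) t = ~~ has (eps_letter I1) t.
Proof. by rewrite -all_predC; apply: eq_all => -[]. Qed.

Lemma all_eps1 t : all (eps_letter I1) t = ~~ has (phi_letter I1) t.
Proof. by rewrite -all_predC; apply: eq_all => -[]. Qed.

Lemma separated_no_inversion s t :
  all (eps_letter I1) s -> all (phi_letter I1) t ->
  has_inversion I1 (s ++ t) = false.
Proof.
rewrite all_eps1 all_phi1 => /negbTE sN /negbTE tN.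
rewrite has_inversion_cat sN /= orbF.
by apply/norP; split; apply/negP => /has_inversion_has; rewrite ?sN ?tN ?andbF.
Qed.

(** For index 1 each letter lies in exactly one of the two classes, so without an inversion the word
    can be cut at its first [phi_letter I1]. *)
Lemma no_inversion_separated w : has_inversion I1 w = false ->
  exists s t, [/\ w = s ++ t, all (eps_letter I1) s & all (phi_letter I1) t].
Proof.
elim: w => [|a w IH] /=; first by exists [::], [::].
case pa: (phi_letter I1 a) => /=.
  move=> /negbT/norP[wP _].
  by exists [::], (a :: w); rewrite /= pa all_phi1.
move=> /IH[s [t [-> sE tP]]]; exists (a :: s), t; split=> //=.
by rewrite sE -[eps_letter I1 a]negbK -phi_letter1E pa.
Qed.

Lemma eps1_Some_separated w m n : eps I1 w = Some m -> phi I1 w = Some n ->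
  exists s t, [/\ w = s ++ t, all (eps_letter I1) s, all (phi_letter I1) t,
                  size s = m & size t = n].
Proof.
move=> /eps_SomeP[/no_inversion_separated[s [t [-> sE tP]]] <-].
move=> /phi_SomeP[_ <-]; exists s, t; split=> //; rewrite count_cat.
- move: (sE) (tP); rewrite all_count all_phi1 has_count -eqn0Ngt.
  by move=> /eqP-> /eqP->; rewrite addn0.
- move: (sE) (tP); rewrite all_eps1 all_count has_count -eqn0Ngt.
  by move=> /eqP-> /eqP->.
Qed.

Lemma separated_eps s t :
  all (eps_letter I1) s -> all (phi_letter I1) t ->
  eps I1 (s ++ t) = Some (size s).
Proof.
move=> sE tP; rewrite /eps separated_no_inversion // count_cat.
move: sE tP; rewrite all_count all_phi1 has_count -eqn0Ngt.
by move=> /eqP-> /eqP->; rewrite addn0.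
Qed.

Lemma separated_phi s t :
  all (eps_letter I1) s -> all (phi_letter I1) t ->
  phi I1 (s ++ t) = Some (size t).
Proof.
move=> sE tP; rewrite /phi separated_no_inversion // count_cat.
move: sE tP; rewrite all_eps1 all_count has_count -eqn0Ngt.
by move=> /eqP-> /eqP->.
Qed.

Lemma e1_separated s a t : all (eps_letter I1) (rcons s a) ->
  all (phi_letter I1) t ->
  e_op I1 (rcons s a ++ t) = Some (s ++ e_letter I1 a :: t).
Proof.
move=> sE tP; rewrite /e_op separated_eps // size_rcons.
rewrite replace_rightmost_cat -[has _ t]negbK -all_phi1 tP /=.
move: sE; rewrite all_rcons => /andP[aE _].
by rewrite /replace_rightmost rev_rcons /= aE rev_cons revK cat_rcons.
Qed.

Lemma f1_separated s a t : all (eps_letter I1) s ->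
  all (phi_letter I1) (a :: t) ->
  f_op I1 (s ++ a :: t) = Some (rcons s (f_letter I1 a) ++ t).
Proof.
move=> sE tP; rewrite /f_op separated_phi //=.
rewrite replace_leftmost_cat -[has _ s]negbK -all_eps1 sE /=.
by move: tP => /= /andP[-> _]; rewrite cat_rcons.
Qed.

(** [e_op I1] is applied [size s2] times on both sides. Each application turns the last letter of
    [s2] into a letter of the other class, which joins [t]; hence the induction from the right. *)
Lemma hypo_rel_map_e s1 s2 t s1' s2' t' :
  all (eps_letter I1) (s1 ++ s2) -> all (phi_letter I1) t ->
  all (eps_letter I1) (s1' ++ s2') -> all (phi_letter I1) t' ->
  size s2 = size s2' -> hypo_rel (s1 ++ s2 ++ t) (s1' ++ s2' ++ t') ->
  hypo_rel (s1 ++ map (e_letter I1) s2 ++ t)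
           (s1' ++ map (e_letter I1) s2' ++ t').
Proof.
elim/last_ind: s2 s2' t t' => [|s2 a IH] s2' t t'.
  by move=> _ _ _ _ /esym/size0nil->.
case/lastP: s2' => [|s2' a']; rewrite ?size_rcons // -!rcons_cat.
move=> sE tP sE' tP' [ss]; rewrite !(catA _ (rcons _ _)) -!rcons_cat => H.
have [v] := hypo_rel_e H (e1_separated sE tP).
rewrite e1_separated // => -[<-] {}H; move: H.
rewrite !map_rcons !cat_rcons -!catA.
move: sE sE'; rewrite !all_rcons => /andP[aE sE] /andP[aE' sE'].
apply: IH => //=; rewrite ?tP ?tP' andbT.
- by case: (a) aE.
- by case: (a') aE'.
Qed.

(** Mirror image: each [f_op I1] passes the first letter of [t1] over to [s]. *)
Lemma hypo_rel_map_f s t1 t2 s' t1' t2' :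
  all (eps_letter I1) s -> all (phi_letter I1) (t1 ++ t2) ->
  all (eps_letter I1) s' -> all (phi_letter I1) (t1' ++ t2') ->
  size t1 = size t1' -> hypo_rel (s ++ t1 ++ t2) (s' ++ t1' ++ t2') ->
  hypo_rel (s ++ map (f_letter I1) t1 ++ t2)
           (s' ++ map (f_letter I1) t1' ++ t2').
Proof.
elim: t1 s s' t1' => [|a t1 IH] s s' [|a' t1'] //= sE tP sE' tP' [ss] H.
have [v] := hypo_rel_f H (f1_separated sE tP).
rewrite f1_separated // => -[<-] {}H.
move: tP tP' => /andP[aP tP] /andP[aP' tP'].
rewrite -!cat_rcons; apply: IH => //; rewrite all_rcons ?sE ?sE' andbT.
- by case: (a) aP.
- by case: (a') aP'.
Qed.

(** * Words that are alone in their class *)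

Definition rigid (w : word) : Prop := forall v, hypo_rel w v -> v = w.

(** The congruence is compatible with the context [p], [q], and the free monoid is cancellative. *)
Lemma rigid_factor p w q : rigid (p ++ w ++ q) -> rigid w.
Proof.
move=> rw v wv; have: p ++ v ++ q = p ++ w ++ q.
  by apply: rw; apply: hypo_rel_cat; [exact: hypo_rel_refl|];
    apply: hypo_rel_cat => //; exact: hypo_rel_refl.
move/eqP; rewrite eqseq_cat // eqxx /= => /eqP E.
move: (congr1 size E); rewrite !size_cat => /addIn sE.
by move/eqP: E; rewrite eqseq_cat // eqxx andbT => /eqP.
Qed.

Lemma eps1_nseq s :
  all (eps_letter I1) s -> count_mem L2 s = 0 -> s = nseq (size s) L1b.
Proof.
move=> sE s2; apply/all_pred1P; elim: s sE s2 => //= -[] s IH //=.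
Qed.

Lemma phi1_nseq t :
  all (phi_letter I1) t -> count_mem L2b t = 0 -> t = nseq (size t) L1.
Proof.
move=> tP t2; apply/all_pred1P; elim: t tP t2 => //= -[] s IH //=.
Qed.


(** Any $\bar2$ present after the replacement is the new one, so mapping over the whole word undoes
    it without knowing its position. *)
Lemma map_e2_replace_leftmost w : ~~ has (eps_letter I2) w ->
  map (e_letter I2) (replace_leftmost (phi_letter I2) (f_letter I2) w) = w.
Proof.
move=> w0; have e2_id s : ~~ has (eps_letter I2) s -> map (e_letter I2) s = s.
  by elim: s => //= -[] s IH //= /IH->.
by elim: w w0 => //= -[] w IH //= w0; rewrite ?IH ?e2_id.
Qed.

(* A congruent word v has no 1-inversion either.  Applying [e_op I1] to all its
   letters in {2, \bar1} but the first removes every 2 among them, so this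
   produces a 2-inversion, as it does in the given word, only if v starts
   with 2. *)
Lemma rigid_2_1b_1 m n : rigid (L2 :: nseq m.+1 L1b ++ nseq n L1).
Proof.
set s0 := nseq m.+1 L1b; set t0 := nseq n L1.
have sE0 : all (eps_letter I1) (L2 :: s0) by rewrite /= all_nseq orbT.
have tP0 : all (phi_letter I1) t0 by rewrite all_nseq orbT.
move=> v H; have := hypo_rel_eps I1 H; have := hypo_rel_phi I1 H.
rewrite -cat_cons separated_phi // separated_eps // => Ep Ee.
have [s [t [Ev sE tP ss st]]] := eps1_Some_separated Ee Ep.
move: ss st; rewrite /= !size_nseq => ss st.
(* These values leave [v] no $\bar2$ and a single $2$. Once that $2$ is known to come first, only
   $\bar1$ remains possible in [s] and only $1$ in [t]. *)
have [] : eps I2 v = Some 0 /\ phi I2 v = Some 1.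
  rewrite (hypo_rel_eps _ H) (hypo_rel_phi _ H) /eps /phi.
  have /negbTE-> : ~~ has_inversion I2 (L2 :: s0 ++ t0).
    apply/negP => /has_inversion_has/andP[_].
    by rewrite /= has_cat !has_nseq !andbF.
  by rewrite /= !count_cat !count_nseq /= !mul0n.
move=> /eps_SomeP[_ Ev0] /phi_SomeP[_ Ev1]; rewrite {}Ev in H Ev0 Ev1 *.
case: s ss sE H Ev0 Ev1 => // x s [ss] sE H Ev0 Ev1.
have := @hypo_rel_map_e [:: L2] s0 t0 [:: x] s t.
rewrite /= size_nseq => /(_ sE0 tP0 sE tP (esym ss) H) /(hypo_rel_eps I2).
have {Ev1} : (x == L2) + count_mem L2 s + count_mem L2 t = 1.
  rewrite -Ev1 /= count_cat addnA.
  by congr (_ + _ + _); [by case: (x) | |]; apply: eq_count => -[].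
have -> : count_mem L2 t = 0.
  by apply/eqP; rewrite eqn0Ngt -has_count -all_predC; apply: sub_all tP => -[].
have {Ev0} t2b : count_mem L2b t = 0.
  move: Ev0; rewrite /= count_cat => E; apply/eqP; rewrite -leqn0.
  suff <- : count (eps_letter I2) t = count_mem L2b t.
    by move: E; case: (count _ t) => // k; rewrite !addnS.
  by apply: eq_count => -[].
move: sE => /= /andP[xE sE].
case: x xE {H} => //= _; rewrite addn0.
- move=> [] /(eps1_nseq sE)-> _; rewrite (phi1_nseq tP t2b) ss st.
  by [].
- move=> _; rewrite /eps /=.
  case: ifP => // /has_inversion_has/andP[].
  rewrite has_cat => /orP[] /hasP[y]; last by move=> /(allP tP); case: y.
  by move=> /mapP[z /(allP sE) zE ->]; case: z zE.
Qed.

(* [f_op I2] turns the final 2 into \bar 2; if this \bar 2 were not the last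
   letter of v, turning all the letters 1 before the last into 2 by [f_op I1]
   would change it to \bar 1 and leave no 2-inversion. *)
Lemma rigid_1b_1_2 m n : rigid (nseq m L1b ++ nseq n.+1 L1 ++ [:: L2]).
Proof.
set s0 := nseq m L1b; set t0 := nseq n.+1 L1.
have sE0 : all (eps_letter I1) s0 by rewrite all_nseq orbT.
have tP0 : all (phi_letter I1) (t0 ++ [:: L2b]).
  by rewrite all_cat all_nseq.
set u := s0 ++ _.
have [eu pu] : eps I2 u = Some 0 /\ phi I2 u = Some 1.
  rewrite /eps /phi.
  have /negbTE-> : ~~ has_inversion I2 u.
    apply/negP => /has_inversion_has/andP[_].
    by rewrite !has_cat !has_nseq !andbF.
  by rewrite !count_cat !count_nseq.
(* The word [u] has a 1-inversion, formed by a $1$ and the final $2$. Replacing this $2$ by $\bar2$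
   removes it and makes the operators of index 1 available. *)
have Fu : f_op I2 u = Some (s0 ++ t0 ++ [:: L2b]).
  rewrite /f_op pu; congr Some.
  by rewrite !replace_leftmost_cat !has_nseq !andbF.
move=> v H; have [v' Ev H'] := hypo_rel_f H Fu.
have := hypo_rel_eps I2 H; have := hypo_rel_phi I2 H.
rewrite eu pu => pv /eps_SomeP[_ v2b].
have [_ v2] := phi_SomeP pv.
move: Ev; rewrite /f_op pv => -[Ev].
have {Ev} vE : v = map (e_letter I2) v'.
  by rewrite -Ev map_e2_replace_leftmost // has_count v2b.
have := hypo_rel_eps I1 H'; have := hypo_rel_phi I1 H'.
rewrite separated_phi // separated_eps // => Ep Ee.
have [s [t [Ev' sE tP ss st]]] := eps1_Some_separated Ee Ep.
move: ss st; rewrite size_cat /= !size_nseq addn1 => ss st.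
have [] : eps I2 v' = Some 1 /\ phi I2 v' = Some 0.
  rewrite (hypo_rel_eps _ H') (hypo_rel_phi _ H') /eps /phi.
  have /negbTE-> : ~~ has_inversion I2 (s0 ++ t0 ++ [:: L2b]).
    apply/negP => /has_inversion_has/andP[].
    by rewrite !has_cat !has_nseq !andbF.
  by rewrite !count_cat !count_nseq.
move=> /eps_SomeP[_ v'2b] /phi_SomeP[_ v'2]; rewrite {}Ev' in H' v'2b v'2 vE.
case/lastP: t tP st H' v'2b v'2 vE => // t y tP; rewrite size_rcons => -[st].
rewrite -cats1 in tP *; move=> H' v'2b v'2 vE.
have := @hypo_rel_map_f s0 t0 [:: L2b] s t [:: y].
rewrite tP sE size_nseq => /(_ sE0 tP0 isT isT (esym st) H').
move/(hypo_rel_eps I2); rewrite [RHS]/eps map_nseq.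
rewrite !has_inversion_cat /= orbT has_nseq /= !orbT.
move: tP; rewrite all_cat /= andbT => /andP[tP yP].
move=> Einv; have y2b : y = L2b.
  case: y yP Einv {H' v'2b v'2 vE} => // _; rewrite /eps.
  case: ifP => // /has_inversion_has/andP[_].
  rewrite !has_cat orbF => /orP[] /hasP[z]; first by move=> /(allP sE); case: z.
  by move=> /mapP[z' /(allP tP) zP ->]; case: z' zP.
rewrite {}vE {}y2b {H' Einv yP} in v'2b v'2 *.
have s2 : count_mem L2 s = 0.
  apply/eqP; rewrite -leqn0 -v'2 count_cat.
  by rewrite -(@eq_count _ (phi_letter I2)) ?leq_addr // => -[].
have t2b : count_mem L2b t = 0.
  apply/eqP; rewrite -leqn0 -ltnS -v'2b !count_cat /= addn1 addnS ltnS.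
  by rewrite -(@eq_count _ (eps_letter I2)) ?leq_addl // => -[].
by rewrite (eps1_nseq sE s2) (phi1_nseq tP t2b) ss st !map_cat !map_nseq.
Qed.

(** * The congruent words $u_n$ and their components *)

(** The end letters are parameters because they are all that changes within the component of
    $u_n$. *)
Definition framed_block n (a b : letter) : word :=
  a :: nseq n L1b ++ nseq n L1 ++ [:: b].

Lemma size_framed_block n a b : size (framed_block n a b) = n.+1.*2.
Proof. by rewrite /= !size_cat !size_nseq !addnS addn0 addnn. Qed.

(** A proper factor misses the first or the last letter, so it is a factor of one of the two rigid
    words. *)
Lemma rigid_framed_block_factor n p w q :
  framed_block n.+1 L2 L2 = p ++ w ++ q ->
  size w < size (framed_block n.+1 L2 L2) -> rigid w.
Proof.
move=> E sw; have: (p != [::]) || (q != [::]).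
  apply: contraTT sw; rewrite E negb_or !negbK => /andP[/eqP-> /eqP->].
  by rewrite cats0 ltnn.
case: p E => [|x p] E.
  case/lastP: q E => // q y; rewrite /= -cats1 => E _.
  apply: (@rigid_factor [::] w q).
  suff -> : [::] ++ w ++ q = L2 :: nseq n.+1 L1b ++ nseq n.+1 L1.
    exact: rigid_2_1b_1.
  move: E; rewrite /framed_block !catA -cat_cons !cats1 => /rcons_inj[].
  by move=> <- _.
move: E => [_ E] _; apply: (@rigid_factor p w q); rewrite -E.
exact: (@rigid_1b_1_2 n.+1 n).
Qed.

(** This map is the isomorphism between two components, and it also carries the action of index 2
    from the two-letter word [[:: a; b]] to blocks. The default [L1] only matters for the empty
    word. *)
Definition reframe n (w : word) := framed_block n (head L1 w) (last L1 w).

Lemma reframe_framed_block m n a b :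
  reframe m (framed_block n a b) = framed_block m a b.
Proof. by rewrite /reframe /framed_block /= !last_cat. Qed.

(** The inner letters $\bar1$ and $1$ are invisible to index 2. *)
Lemma has_inversion2_framed_block n a b :
  has_inversion I2 (framed_block n a b) = has_inversion I2 [:: a; b].
Proof.
rewrite /framed_block /= !has_inversion_cat !has_cat !has_nseq /= !andbF !orbF.
have block x : eps_letter I2 x || phi_letter I2 x = false ->
    has_inversion I2 (nseq n x) = false.
  move=> /norP[xE _]; apply/negP => /has_inversion_has/andP[_].
  by rewrite has_nseq (negbTE xE) andbF.
by rewrite !block /= ?orbF.
Qed.

Lemma eps2_framed_block n a b : eps I2 (framed_block n a b) = eps I2 [:: a; b].
Proof.
rewrite /eps has_inversion2_framed_block.
by rewrite /framed_block /= !count_cat !count_nseq /= !mul0n.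
Qed.

Lemma phi2_framed_block n a b : phi I2 (framed_block n a b) = phi I2 [:: a; b].
Proof.
rewrite /phi has_inversion2_framed_block.
by rewrite /framed_block /= !count_cat !count_nseq /= !mul0n.
Qed.

Lemma e2_framed_block n a b :
  e_op I2 (framed_block n a b) = omap (reframe n) (e_op I2 [:: a; b]).
Proof.
rewrite /e_op eps2_framed_block; case: eps => [[|k]|] //=; congr Some.
rewrite /framed_block -cat1s !replace_rightmost_cat !has_cat !has_nseq !andbF.
by rewrite /reframe; case: a; case: b; rewrite /= ?last_cat.
Qed.

Lemma f2_framed_block n a b :
  f_op I2 (framed_block n a b) = omap (reframe n) (f_op I2 [:: a; b]).
Proof.
rewrite /f_op phi2_framed_block; case: phi => [[|k]|] //=; congr Some.
rewrite /framed_block /= !replace_leftmost_cat !has_nseq !andbF.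
by rewrite /reframe; case: a; case: b; rewrite /= ?last_cat.
Qed.

(** The orbit of the word $22$ under index 2: $22 \mapsto \bar2 2 \mapsto \bar2\bar2$ by
    [f_op I2]. *)
Definition frame_ends := [:: (L2, L2); (L2b, L2); (L2b, L2b)].

Lemma inversion1_undefined w : has_inversion I1 w ->
  [/\ eps I1 w = None, phi I1 w = None, e_op I1 w = None & f_op I1 w = None].
Proof. by rewrite /e_op /f_op /eps /phi => ->. Qed.

(** The block is nonempty, so a final $2$ preceded by $1$, or an initial $\bar2$ followed by
    $\bar1$, gives a 1-inversion. *)
Lemma frame_ends_undefined n a b : (a, b) \in frame_ends ->
  let w := framed_block n.+1 a b in
  [/\ eps I1 w = None, phi I1 w = None, e_op I1 w = None & f_op I1 w = None].
Proof.
move=> ab w; apply: inversion1_undefined; rewrite /w /framed_block -cat1s.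
rewrite !has_inversion_cat !has_cat !has_nseq; move: ab.
by rewrite !inE => /or3P[] /eqP[-> ->] /=; rewrite ?orbT.
Qed.

Lemma component_framed_block n x : component (framed_block n.+1 L2 L2) x ->
  exists2 ab, ab \in frame_ends & x = framed_block n.+1 ab.1 ab.2.
Proof.
elim=> [|[] _ y _ [[a b] ab ->]|[] _ y _ [[a b] ab ->]] /=.
- by exists (L2, L2).
- by have [_ _ -> _] := frame_ends_undefined n ab.
- rewrite e2_framed_block; move: ab.
  rewrite !inE => /or3P[] /eqP[-> ->] //= [<-].
  + by exists (L2, L2).
  + by exists (L2b, L2).
- by have [_ _ _ ->] := frame_ends_undefined n ab.
- rewrite f2_framed_block; move: ab.
  rewrite !inE => /or3P[] /eqP[-> ->] //= [<-].
  + by exists (L2b, L2).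
  + by exists (L2b, L2b).
Qed.

(** The letters $\bar1$ and $1$ of the block are equally many and cancel. *)
Lemma wt_framed_block n a b : wt (framed_block n a b) = wt [:: a; b].
Proof.
have wt0 : wt (nseq n L1b ++ nseq n L1) = (0%R, 0%R).
  by rewrite /wt !count_cat !count_nseq /= !mul0n !mul1n !addn0 !GRing.subrr.
rewrite /framed_block -cat1s [nseq n L1b ++ _]catA.
rewrite wt_cat [wt (_ ++ [:: b])]wt_cat wt0.
by rewrite -[[:: a; b]]/([:: a] ++ [:: b]) wt_cat /= !GRing.add0r.
Qed.

Lemma hypo_rel_framed_block m n :
  hypo_rel (framed_block m.+1 L2 L2) (framed_block n.+1 L2 L2).
Proof.
exists (reframe n.+1); apply: quasi_crystal_isoI; last 1 first.
- move=> _ /component_framed_block[[a b] ab ->] /=.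
  rewrite reframe_framed_block.
  split; first by rewrite !wt_framed_block.
  case; first by have [-> -> -> ->] := frame_ends_undefined m ab;
    have [-> -> -> ->] := frame_ends_undefined n ab.
  rewrite !(eps2_framed_block, phi2_framed_block).
  rewrite !(e2_framed_block, f2_framed_block).
  split=> //.
  + by case: (e_op I2 _) => //= w; rewrite reframe_framed_block.
  + by case: (f_op I2 _) => //= w; rewrite reframe_framed_block.
- move=> x y /component_framed_block[[a b] _ ->].
  move=> /component_framed_block[[a' b'] _ ->] /=.
  rewrite !reframe_framed_block.
  move=> E; move: (congr1 (head L1) E) (congr1 (last L1) E).
  by rewrite /= !last_cat /= !last_cat /= => -> ->.
- by rewrite reframe_framed_block.
Qed.

(** * No finite set of generators *)

Lemma generated_rel_isolated (A : eqType) (S : seq (seq A * seq A)) w :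
  (forall u v p q, (u, v) \in S -> (p ++ u ++ q = w) <-> (p ++ v ++ q = w)) ->
  forall v, generated_rel S w v -> v = w.
Proof.
(* Quantifying over all contexts lets the induction pass through [gen_cat], where the two factors
   are exchanged one after the other. *)
move=> base; have fixed u v : generated_rel S u v -> forall p q,
    (p ++ u ++ q = w) <-> (p ++ v ++ q = w).
  elim=> {u v} [u v uv p q|//|u v _ IH p q|u v t _ IH1 _ IH2 p q|].
  - exact: base.
  - by split=> /IH.
  - by split=> [/IH1/IH2|/IH2/IH1].
  - move=> u v u' v' _ IH1 _ IH2 p q; rewrite -!catA.
    by rewrite IH1 !(catA p v) IH2.
by move=> v /fixed/(_ [::] [::]); rewrite /= !cats0 => -[/(_ erefl)].
Qed.

Lemma hypo_not_finitely_generated : ~ finitely_generated hypo_congruence.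
Proof.
(* [n] bounds both sides of every generator, while [w n] is $u_{n+1}$, of length $2(n+2)$. *)
move=> [S SP]; pose n := \max_(uv <- S) maxn (size uv.1) (size uv.2).
pose w k := framed_block k.+1 L2 L2.
have size_w k : size (w k) = k.+2.*2 by rewrite /w size_framed_block.
have short u v : (u, v) \in S -> size u < size (w n) /\ size v < size (w n).
  move=> uv; have : maxn (size u) (size v) <= n.
    exact: (leq_bigmax_seq (u, v) uv isT).
  have nw : n < size (w n) by rewrite size_w -addnn; apply: ltn_addr.
  by rewrite geq_max => /andP[un vn]; split; apply: leq_ltn_trans nw.
have : w n.+1 = w n.
  apply: (@generated_rel_isolated _ S); last first.
    by apply/SP; exact: hypo_rel_framed_block.
  move=> u v p q uv; have [su sv] := short _ _ uv.
  have huv : hypo_rel u v by apply/(SP u v); exact: gen_base.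
  (* The side that occurs in [w n] is too short to be all of it, hence rigid and equal to the other
     side. *)
  split=> E.
  - by rewrite ((rigid_framed_block_factor (esym E) su) _ huv).
  - by rewrite ((rigid_framed_block_factor (esym E) sv) _ (hypo_rel_sym huv)).
move/(congr1 size)/eqP; rewrite !size_w (inj_eq double_inj) !eqSS.
by rewrite eqn_leq ltnn.
Qed.

(** * Change of generators in a finite presentation *)

Lemma finitely_generated_of_presented (A : finType) (C : congruence A) :
  finitely_presented (quotient_monoid C) -> finitely_generated C.
Proof.
move=> [B [S [f [[f1 fM] [g gK fK]]]]].
pose CB := generated_congruence S.
have pi_cat (D : choiceType) (E : congruence D) u v :
    \pi_(quotient_monoid E) (u ++ v) =
    mul (\pi_(quotient_monoid E) u) (\pi_(quotient_monoid E) v).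
  by rewrite -quotient_mulE.
(* Representatives of the images of letters lift [f] and its inverse [g] to morphisms [H] and [K] of
   free monoids. *)
pose h b : seq A := repr (f (\pi_(quotient_monoid CB) [:: b])).
pose k a : seq B := repr (g (\pi_(quotient_monoid C) [:: a])).
pose H u := flatten (map h u); pose K u := flatten (map k u).
have HP u : \pi_(quotient_monoid C) (H u) = f (\pi_(quotient_monoid CB) u).
  elim: u => [|b u IH]; first by rewrite f1.
  by rewrite -[b :: u]cat1s pi_cat fM /= -IH /H /= pi_cat reprK.
have Hcat u v : H (u ++ v) = H u ++ H v by rewrite /H map_cat flatten_cat.
have gM : {morph g : x y / mul x y}.
  by move=> x y; apply: (can_inj gK); rewrite fM !fK.
have KP u : \pi_(quotient_monoid CB) (K u) = g (\pi_(quotient_monoid C) u).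
  elim: u => [|a u IH]; first by apply: (can_inj gK); rewrite fK f1.
  by rewrite -[a :: u]cat1s pi_cat gM /= -IH /K /= pi_cat reprK.
(* The first family transports the given relations; the second identifies each letter with its round
   trip through [B]. *)
pose T := [seq (H uv.1, H uv.2) | uv <- S] ++ [seq ([:: a], H (k a)) | a : A].
have [Crefl Csym Ctr Ccat] := congruenceP C.
exists T => u v; split.
- move=> /quotient_eqP uv.
  have HK w : generated_rel T w (H (K w)).
    elim: w => [|a w IH]; first exact: gen_refl.
    rewrite -cat1s -[K _]/(k a ++ K w) Hcat.
    apply: gen_cat => //; apply: gen_base; rewrite mem_cat; apply/orP; right.
    by apply/mapP; exists a; rewrite ?mem_enum.
  (* The chain is [u], [H (K u)], [H (K v)], [v]; its middle link is the image under [H] of a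
     derivation from [S]. *)
  apply: gen_trans (HK u) (gen_trans _ (gen_sym (HK v))).
  have {uv} : generated_rel S (K u) (K v).
    by apply/(quotient_eqP CB); rewrite !KP uv.
  elim=> {u v} [u v uv|u|u v _|u v w _ IH1 _|u v u' v' _ IH _ IH'].
  + apply: gen_base; rewrite mem_cat; apply/orP; left.
    by apply/mapP; exists (u, v).
  + exact: gen_refl.
  + exact: gen_sym.
  + exact: gen_trans.
  + by rewrite !Hcat; exact: gen_cat.
- elim=> {u v} [u v|u|u v _|u v w _ IH1 _|u v u' v' _ IH _ IH'] //.
  + rewrite mem_cat => /orP[/mapP[[x y] xy [-> ->]]|/mapP[a _ [-> ->]]].
      apply/quotient_eqP; rewrite !HP; congr f.
      by apply/quotient_eqP; exact: gen_base.
    by apply/quotient_eqP; rewrite HP reprK fK.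
  + exact: Csym.
  + exact: Ctr.
  + exact: Ccat.
Qed.

Theorem theorem9p36 :
  ~ finitely_generated hypo_congruence /\ ~ finitely_presented hypo_C2.
Proof.
split; first exact: hypo_not_finitely_generated.
by move/finitely_generated_of_presented; exact: hypo_not_finitely_generated.
Qed.
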